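(* Assume that $X$ is a convex, closed and non-empty subset of $\mathbb{R}^n=\prod_{\nu\in N}\mathbb{R}^{n_\nu}$, and that for each $\nu\in N$ the objective function $\theta_\nu:\mathbb{R}^n\to\mathbb{R}$ is pseudo-continuous. Suppose there exists $\rho>0$ such that (i) $X\cap\overline{B}_\rho\ne\emptyset$, and (ii) for each $x\in X\setminus\overline{B}_\rho$ there exists $y\in\mathcal{X}(x)$ such that $(y^\nu,x^{-\nu})\in\overline{B}_\rho$ and $\theta_\nu(y^\nu,x^{-\nu})\le\theta_\nu(x)$ for all $\nu\in N$. If each $\theta_\nu$ is quasi-convex with respect to its player's variable, then the set $\mathrm{RGNEP}(\{\theta_\nu,X\}_{\nu\in N})$ is non-empty.
   Context: $N$ is a finite non-empty set of players. For $x\in\mathbb{R}^n$, write $x=(x^\nu,x^{-\nu})$, where $x^\nu\in\mathbb{R}^{n_\nu}$ is the component of player $\nu$ and $x^{-\nu}$ collects the components of the other players. $\|\cdot\|$ is a norm on $\mathbb{R}^n$ and $\overline{B}_\rho=\{x:\|x\|\le\rho\}$. $X_\nu(x^{-\nu}):=\{x^\nu\in\mathbb{R}^{n_\nu}:(x^\nu,x^{-\nu})\in X\}$ and $\mathcal{X}(x):=\prod_{\nu\in N}X_\nu(x^{-\nu})$. $\mathrm{RGNEP}(\{\theta_\nu,X\}_{\nu\in N})$ is the set of generalized Nash equilibria of Rosen's game: all $\hat x\in X$ such that for every $\nu\in N$ and every $x^\nu\in\mathbb{R}^{n_\nu}$ with $(x^\nu,\hat x^{-\nu})\in X$ one has $\theta_\nu(\hat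 x)\le\theta_\nu(x^\nu,\hat x^{-\nu})$. A function $f:\mathbb{R}^n\to\mathbb{R}$ is upper pseudo-continuous if for any $x,y\in\mathbb{R}^n$ with $f(x)<f(y)$ there is a neighbourhood $V_x$ of $x$ such that $f(x')<f(y)$ for all $x'\in V_x$; it is lower pseudo-continuous if $-f$ is upper pseudo-continuous; it is pseudo-continuous if it is both. A function $f$ is quasi-convex if $f(tx+(1-t)y)\le\max\{f(x),f(y)\}$ for all $x,y$ and $t\in[0,1]$; $\theta_\nu$ is quasi-convex with respect to its player's variable if $\theta_\nu(\cdot,x^{-\nu})$ is quasi-convex on $\mathbb{R}^{n_\nu}$ for every $x^{-\nu}$. *)

(* Defs.v *)
From HB Require Import structures.
From mathcomp Require Import all_boot all_order all_algebra.
From mathcomp Require Import all_classical all_reals all_analysis.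

Set Implicit Arguments.
Unset Strict Implicit.
Unset Printing Implicit Defensive.

Import Order.TTheory GRing.Theory Num.Theory.
Import numFieldNormedType.Exports.

Local Open Scope classical_set_scope.
Local Open Scope ring_scope.

(* R^n = \prod_(nu : N) R^(n nu), with the product topology and the
   componentwise vector space structure.  The library provides the latter only
   for non-dependent products. *)
Definition profile (R : realType) (N : finType) (n : N -> nat) : Type :=
  prod_topology (fun nu : N => 'rV[R]_(n nu)).

Section ProfileStructures.
Context {R : realType} {N : finType} {n : N -> nat}.
Implicit Types x y z : profile R n.

HB.instance Definition _ :=
  Topological.copy (profile R n)
    (prod_topology (fun nu : N => 'rV[R]_(n nu))).

Let zerop : profile R n := fun=> 0.
Let oppp x : profile R n := fun nu => - x nu.
Let addp x y : profile R n := fun nu => x nu + y nu.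
Let scalep (a : R) x : profile R n := fun nu => a *: x nu.

Let addpA : associative addp.
Proof. by move=> x y z; apply: functional_extensionality_dep => nu; exact: addrA. Qed.

Let addpC : commutative addp.
Proof. by move=> x y; apply: functional_extensionality_dep => nu; exact: addrC. Qed.

Let add0p : left_id zerop addp.
Proof. by move=> x; apply: functional_extensionality_dep => nu; exact: add0r. Qed.

Let addNp : left_inverse zerop oppp addp.
Proof. by move=> x; apply: functional_extensionality_dep => nu; exact: addNr. Qed.

HB.instance Definition _ :=
  GRing.isZmodule.Build (profile R n) addpA addpC add0p addNp.

Let scalepA a b x : scalep a (scalep b x) = scalep (a * b) x.
Proof. by apply: functional_extensionality_dep => nu; exact: scalerA. Qed.

Let scale1p : left_id 1 scalep.
Proof. by move=> x; apply: functional_extensionality_dep => nu; exact: scale1r. Qed.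

Let scalepDr : right_distributive scalep +%R.
Proof. by move=> a x y; apply: functional_extensionality_dep => nu; exact: scalerDr. Qed.

Let scalepDl x : {morph scalep^~ x : a b / a + b}.
Proof. by move=> a b; apply: functional_extensionality_dep => nu; exact: scalerDl. Qed.

HB.instance Definition _ :=
  GRing.Zmodule_isLmodule.Build R (profile R n) scalepA scale1p scalepDr scalepDl.

End ProfileStructures.

Definition is_norm (R : numDomainType) (V : lmodType R) (p : V -> R) : Prop :=
  [/\ forall x, 0 <= p x,
      forall x, p x = 0 -> x = 0,
      forall (a : R) x, p (a *: x) = `|a| * p x
    & forall x y, p (x + y) <= p x + p y].

(* The radius-rho ball centred at 0 of the norm p, which need not be the one
   that the library attaches to V (if any). *)
Definition norm_closed_ball (R : numDomainType) (V : lmodType R)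
  (p : V -> R) (rho : R) : set V := [set x | p x <= rho].

Definition upper_pseudo_continuous (R : realType) (T : topologicalType)
    (f : T -> R) : Prop :=
  forall x y, f x < f y -> \forall x' \near x, f x' < f y.

Definition lower_pseudo_continuous (R : realType) (T : topologicalType)
    (f : T -> R) : Prop :=
  upper_pseudo_continuous (fun x => - f x).

Definition pseudo_continuous (R : realType) (T : topologicalType)
    (f : T -> R) : Prop :=
  upper_pseudo_continuous f /\ lower_pseudo_continuous f.

Definition quasi_convex (R : realType) (V : lmodType R) (f : V -> R) : Prop :=
  forall (x y : V) (t : R), 0 <= t <= 1 ->
    f (t *: x + (1 - t) *: y) <= Num.max (f x) (f y).

Section RosenGame.
Context {R : realType} {N : finType} {n : N -> nat}.

(* The profile (y, x^{-nu}). *)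
Definition deviate (x : profile R n) (nu : N) (y : 'rV[R]_(n nu)) :
  profile R n := dfwith x nu y.

(* X_nu(x^{-nu}); it does not depend on the component x nu. *)
Definition strategy_set (X : set (profile R n)) (nu : N) (x : profile R n) :
  set 'rV[R]_(n nu) := [set y | X (deviate x y)].

(* The product of the sets X_nu(x^{-nu}). *)
Definition strategy_sets (X : set (profile R n)) (x : profile R n) :
  set (profile R n) := [set y | forall nu, strategy_set X x (y nu)].

Definition own_quasi_convex (nu : N) (f : profile R n -> R) : Prop :=
  forall x : profile R n, quasi_convex (fun y : 'rV[R]_(n nu) => f (deviate x y)).

Definition RGNEP (theta : N -> profile R n -> R) (X : set (profile R n)) :
    set (profile R n) :=
  [set x | X x /\
    forall (nu : N) (y : 'rV[R]_(n nu)),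
      X (deviate x y) -> theta nu x <= theta nu (deviate x y)].

End RosenGame.

(* Main.v *)
From HB Require Import structures.
Require Import Defs.
From mathcomp Require Import all_boot all_order all_algebra.
From mathcomp Require Import all_classical all_reals all_analysis.
From mathcomp Require Import zify lra.

Set Implicit Arguments.
Unset Strict Implicit.
Unset Printing Implicit Defensive.

Import Order.TTheory GRing.Theory Num.Theory.
Import numFieldNormedType.Exports.

(** The equilibrium is found in the compact convex set
    K = X `&` norm_closed_ball p rho, and the coercivity hypothesis is only used
    to get from K back to X: if x is an equilibrium over K and some z in X,
    differing from x in the component of nu only, were better for nu, then z
    would lie outside the ball, and the hypothesis at z would give a point of K,
    again differing from x in that component only, which is at least as good as
    z and so strictly better than x.

    For a compact convex K ([compact_game_equilibrium]), the components of a
    point of K cannot be varied independently: a profile of best replies need not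
    lie in K, so a fixed point of the best replies is out of reach.  Quasi-convexity
    is used in its dual form instead.  The set of better replies of nu at x is
    convex and does not contain x nu, hence has a normal a nu of norm 1 there; if
    it is empty, any a nu of norm at most 1 is admitted.  Call y a descent point
    at x when \sum_nu <a nu, y nu - x nu> < 0 for every admissible family a.
    - A better reply of a single player gives a descent point: better replies
      form an open set, so a normal is strictly negative on it
      ([unit_normal_lt0]).  If K had no equilibrium, every x in K would then have
      a descent point in K.
    - The descent points at x form a convex set, and for fixed y the set of x at
      which y is a descent point is open: the relation ``z is a better reply at
      x'' is open by pseudo-continuity, and a ranges over a compact set
      ([descent_open]).
    - Browder's fixed point theorem ([browder_fixed_point]) gives x in K which is
      a descent point at itself.  As admissible families exist
      ([unit_normal_exists]), this reads 0 < 0.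

    Browder's theorem is reduced, by a finite subcover and the map from a simplex
    given by convex combinations, to a covering property of the simplex
    ([open_cover_simplex]) that has the strength of Brouwer's theorem.  The
    latter comes from Scarf's combinatorial lemma ([scarf]), applied to the
    points of a fine grid ordered by each of their coordinates; this replaces
    triangulations and Sperner's lemma by a parity argument on finite ordered
    sets. *)

(** * Scarf's lemma *)

Section Scarf.
Local Open Scope set_scope.

Context {T I : finType}.
Variables (r : I -> T -> nat) (c : T -> I) (t0 : T) (i0 : I).
Hypothesis r_inj : forall i, injective (r i).

Local Notation U := (T + I)%type.

Let height : nat := (\max_i \max_t r i t).+1.

(** Each order i receives an artificial point [inr i], the least one for the
    order i and above all genuine points for the other orders.  With these points
    every dominant set can be completed to one with exactly #|I| points, so that
    only one kind of incidence, adding or removing a point, has to be counted. *)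
Definition scarf_rank (i : I) (u : U) : nat :=
  match u with
  | inl t => (r i t).+1
  | inr j => if j == i then 0%N else (height.+1 + enum_rank j)%N
  end.

Definition scarf_label (u : U) : I :=
  match u with inl t => c t | inr j => j end.

Local Notation rk := scarf_rank.
Local Notation lab := scarf_label.

Let rk_real i t j : j != i -> (rk i (inl t) < rk i (inr j))%N.
Proof.
move=> /negPf /= ->.
have h1 := @leq_bigmax _ (r i) t.
have h2 := @leq_bigmax _ (fun i => \max_t r i t) i.
have : (r i t < height)%N by rewrite /height ltnS; exact: leq_trans h1 h2.
lia.
Qed.

Let rk_inj i : injective (rk i).
Proof.
have hne t j : rk i (inl t) <> rk i (inr j).
  case: (eqVneq j i) => [-> /=|ne]; first by rewrite eqxx.
  by move=> e; have := rk_real t ne; rewrite e ltnn.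
case=> [t|j] [t'|j'].
- by move=> /= [] /r_inj ->.
- by move=> /hne.
- by move=> /esym /hne.
- rewrite /=; case: eqP => [->|_]; case: eqP => [->|_] // /addnI.
  by move=> /ord_inj /enum_rank_inj ->.
Qed.

(** Taking y in A shows that every point of a dominant set A is its minimum for
    some order, whence #|A| <= #|I|. *)
Definition dominant (A : {set U}) : bool :=
  [forall y, exists i, [forall x in A, rk i y <= rk i x]]%N.

Let domP (A : {set U}) : reflect (forall y, exists i, forall x, x \in A -> (rk i y <= rk i x)%N)
  (dominant A).
Proof.
apply: (iffP forallP) => h y; have := h y.
  by move=> /existsP [i /forall_inP hi]; exists i.
by move=> [i hi]; apply/existsP; exists i; apply/forall_inP.
Qed.

Let dominantS (A B : {set U}) : A \subset B -> dominant B -> dominant A.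
Proof.
move=> /fintype.subsetP sAB /domP dB; apply/domP => y.
by have [i hi] := dB y; exists i => x /sAB; exact: hi.
Qed.

(** The analogue of the facets without the label i0 in Sperner's lemma; the labels
    of a door are pairwise distinct. *)
Let door (D : {set U}) : bool :=
  (#|D|.+1 == #|I|) && (lab @: D == [set~ i0]).

Let door0 : {set U} := [set inr j | j in [set~ i0]].

Let door0P : door door0.
Proof.
rewrite /door /door0 card_imset; last by move=> i j [].
rewrite cardsC1 -imset_comp.
have /card_gt0P h : exists i, i \in I by exists i0.
by rewrite prednK // eqxx /= (eq_imset (g := id)) ?imset_id.
Qed.

Let extensions (D : {set U}) : {set U} := [set x | (x \notin D) && dominant (x |: D)].

(** The only dominant extension of the all-artificial door adds the maximum of
    the order i0. *)
Let extensions0 : #|extensions door0| = 1%N.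
Proof.
pose tm := [arg max_(t > t0) r i0 t]%N.
have tmP t : (r i0 t <= r i0 tm)%N.
  by rewrite /tm; case: arg_maxnP => // t' _; apply.
rewrite (_ : extensions _ = [set inl tm]) ?cards1 //; apply/setP => x.
have in0 j : (inr j \in door0) = (j != i0).
  by rewrite /door0 mem_imset ?inE // => a b [].
rewrite !inE; apply/andP/eqP => [[xN /domP dx]|->]; last first.
  split; first by apply/negP => /imsetP [].
  apply/domP => [[t|j]]; last by exists j => x' _ /=; rewrite eqxx.
  exists i0 => x'; rewrite !inE => /orP [/eqP ->|/imsetP [j]].
    by rewrite /= ltnS.
  by rewrite !inE => ne ->; apply/ltnW/rk_real.
case: x xN dx => [t|j] xN dx; last first.
  have := in0 j; rewrite (negPf xN) => /esym/negPn/eqP ?; subst j.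
  have [i hi] := dx (inl t0).
have := hi (inr i). rewrite /= eqxx !inE. rewrite in0.
  by case: (eqVneq i i0) => [->|_] /=; rewrite ?eqxx ?orbT => /(_ isT).
have [i hi] := dx (inl tm).
have ii : i = i0.
  apply/eqP; apply: contraT => ne; have := hi (inr i).
  by rewrite /= eqxx !inE in0 ne => /(_ isT).
subst i; have := hi (inl t); rewrite !inE eqxx /= ltnS => /(_ isT) h.
have /eqP : r i0 t = r i0 tm by apply/eqP; rewrite eqn_leq tmP h.
by move=> /eqP/r_inj ->.
Qed.

(** Among the minima of D for the #|I| orders, each of the #|I| - 1 points of D
    occurs, so exactly one of them occurs twice, for orders i1 and i2.  A point
    that extends D must take over the minimum of i1 or of i2; for i = i1 it has
    to lie above the minimum of D for all the orders but i, and is then the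
    greatest such point for the order i.  Thus each of i1 and i2 gives one
    extension. *)
Let extensions2 D : door D -> D != door0 -> dominant D -> #|extensions D| = 2.
Proof.
move=> /andP [/eqP cD /eqP lD] ne0 /domP dD.
(* A door without genuine points is included in [door0], hence equal to it. *)
have [t tD] : exists t, inl t \in D.
  apply: contrapT => nt; move/eqP: ne0; apply; apply/eqP.
  rewrite eqEcard; have /andP [/eqP c0 _] := door0P.
  have -> : (#|door0| <= #|D|)%N by rewrite -ltnS c0 cD.
  rewrite andbT; apply/fintype.subsetP => [[t|j]] h; first by case: nt; exists t.
  apply/imsetP; exists j => //; rewrite -lD.
  by apply/imsetP; exists (inr j).
pose m i := [arg min_(x < inl t in D) rk i x]%N.
have mD i : m i \in D by rewrite /m; case: arg_minnP.
have mle i x : x \in D -> (rk i (m i) <= rk i x)%N.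
  by move=> xD; rewrite /m; case: arg_minnP => // y _; apply.
have mE i d : (forall x, x \in D -> (rk i d <= rk i x)%N) -> d \in D -> d = m i.
  by move=> h dD'; apply: (@rk_inj i); apply/eqP; rewrite eqn_leq h // mle.
have msur d : d \in D -> exists i, d = m i.
  by move=> dD'; have [i hi] := dD d; exists i; exact: mE.
have mim : m @: [set: I] = D.
  apply/eqP; rewrite finset.eqEsubset; apply/andP; split; apply/fintype.subsetP => d.
    by move=> /imsetP [i _ ->].
  by move=> /msur [i ->]; exact: imset_f.
have : ~~ injectiveb m.
  apply/negP => /injectiveP mi; have := card_imset [set: I] mi.
  by rewrite mim cardsT -cD => /eqP; rewrite eqn_leq ltnn andbF.
move=> /injectivePn [i1 [i2 n12 m12]].
(* Removing either of the two colliding orders keeps [m] onto. *)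
have mC i : i \in [set i1; i2] -> forall d, d \in D -> exists2 j, j != i & d = m j.
  rewrite !inE => hi d /msur [j ->]; case: (eqVneq j i) => [->|ne]; last by exists j.
  case/orP: hi => /eqP ->; first by exists i2 => //; rewrite eq_sym.
  by exists i1.
have mC' i : i \in [set i1; i2] -> m @: [set~ i] = D.
  move=> hi; apply/eqP; rewrite finset.eqEsubset; apply/andP; split.
    by apply/fintype.subsetP => d /imsetP [j _ ->].
  apply/fintype.subsetP => d /(mC _ hi) [j nj ->]; apply: imset_f.
  by rewrite !inE.
(* The points that may take over the minimum for the order [i]. *)
pose M i : {set U} := [set y | [forall j, (j != i) ==> (rk j (m j) < rk j y)%N]].
have MP i y : reflect (forall j, j != i -> (rk j (m j) < rk j y)%N) (y \in M i).
  rewrite inE; apply: (iffP forallP) => h j; first by move/implyP: (h j).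
  by apply/implyP; exact: h.
(* The genuine point [t] of D bounds all the minima of D. *)
have sM i : inr i \in M i.
  apply/MP => j ne; apply: leq_ltn_trans (mle _ _ tD) (rk_real _ _).
  by rewrite eq_sym.
pose e i := [arg max_(y > inr i in M i) rk i y]%N.
have eM i : e i \in M i by rewrite /e; case: arg_maxnP.
have eP i y : y \in M i -> (rk i y <= rk i (e i))%N.
  by move=> h; rewrite /e; case: arg_maxnP => // z _; apply.
have eND i : i \in [set i1; i2] -> e i \notin D.
  move=> hi; apply/negP => /(mC _ hi) [j nj ej].
  by have /MP := eM i => /(_ j nj); rewrite ej ltnn.
have elt i : i \in [set i1; i2] -> (rk i (e i) < rk i (m i))%N.
  move=> hi; have [k hk] := dD (e i).
  case: (eqVneq k i) => [ki|ne]; last first.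
    have /MP/(_ k ne) := eM i.
    by rewrite ltnNge hk.
  subst k; rewrite ltn_neqAle hk // andbT; apply/eqP => /rk_inj ei.
  by move: (eND _ hi); rewrite ei mD.
have -> : extensions D = [set e i1; e i2].
  apply/setP => x; apply/idP/idP; last first.
    rewrite in_set2 => xe; have [i hi ->] : exists2 i, i \in [set i1; i2] & x = e i.
      case/orP: xe => /eqP ->.
        by exists i1; rewrite // !inE eqxx.
      by exists i2; rewrite // !inE eqxx orbT.
    rewrite inE eND //=; apply/domP => y.
    case: (boolP (y \in M i)) => [yM|].
      exists i => z; rewrite !inE => /orP [/eqP ->|zD]; first exact: eP.
      apply: leq_trans (eP _ _ yM) _; apply: leq_trans (ltnW (elt _ hi)) _.
      exact: mle.
    rewrite inE negb_forall => /existsP [j]; rewrite negb_imply -leqNgt.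
    move=> /andP [nj hj]; exists j => z; rewrite !inE => /orP [/eqP ->|zD].
      by apply: leq_trans hj (ltnW _); move/MP: (eM i); apply.
    exact: leq_trans hj (mle _ _ zD).
  rewrite inE in_set2 => /andP [xD /domP dx].
  have xneq i : rk i (m i) != rk i x.
    by apply/eqP => /rk_inj xm; move: xD; rewrite -xm mD.
  have [i hi] := dx x.
  have xi : (rk i x < rk i (m i))%N.
    by rewrite ltn_neqAle eq_sym xneq hi // !inE mD orbT.
  (* The orders whose minimum [x] takes over; the others must still reach D. *)
  pose Q : {set I} := [set k | (rk k x < rk k (m k))%N].
  have mQ : D \subset m @: ~: Q.
    apply/fintype.subsetP => d dD'; have [k hk] := dx d.
    have dm : d = m k by apply: mE => // z zD; apply: hk; rewrite !inE zD orbT.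
    rewrite dm; apply: imset_f; rewrite !inE -leqNgt -dm; apply: hk.
    by rewrite !inE eqxx.
  have Qi : Q = [set i].
    apply/eqP; rewrite eq_sym eqEcard finset.sub1set inE xi /= cards1.
    have := leq_trans (subset_leq_card mQ) (leq_imset_card _ _).
    have := cardsC Q; rewrite -cD; lia.
  have xM : x \in M i.
    apply/MP => k nk; rewrite ltn_neqAle xneq /= leqNgt.
    have /setP/(_ k) := Qi; rewrite !inE => ->; exact: nk.
  have i12 : i \in [set i1; i2].
    apply: contraT => ni.
    have /imset_injP mi : #|m @: [set~ i]| == #|[set~ i]|.
      rewrite eqn_leq leq_imset_card /= cardsC1 -cD -Qi.
      exact: subset_leq_card.
    move: ni; rewrite !inE negb_or => /andP [ni1 ni2].
    by move: n12; rewrite (mi i1 i2) ?eqxx // !inE eq_sym.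
  have -> : x = e i.
    apply: (@rk_inj i); apply/eqP; rewrite eqn_leq eP //=.
    have [k hk] := dx (e i).
    case: (eqVneq k i) => [ki|nk]; first by subst k; apply: hk; rewrite !inE eqxx.
    have /MP/(_ k nk) := eM i; rewrite ltnNge hk //.
    by rewrite !inE mD orbT.
  by move: i12; rewrite !inE => /orP [] /eqP ->; rewrite eqxx ?orbT.
rewrite cards2; suff -> : e i1 != e i2 by [].
apply/eqP => e12; have := elt i2; rewrite !inE eqxx orbT => /(_ isT).
have /MP/(_ i2) := eM i1; rewrite eq_sym => /(_ n12).
by rewrite e12 ltnNge => /negPf h /ltnW; rewrite h.
Qed.

Let room_doors (X : {set U}) : {set U} := [set x in X | door (X :\ x)].

(** If X has a repeated label, the two points that share it are the only ones
    whose removal can leave a door. *)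
Let odd_room_doors X : odd #|room_doors X| -> lab @: X = [set: I].
Proof.
move=> od; have [x xin] : exists x, x \in room_doors X.
  by apply/set0Pn; apply: contraTneq od => ->; rewrite cards0.
have := xin; rewrite inE => /andP [xX /andP [/eqP cx /eqP lx]].
have cX : #|X| = #|I| by rewrite -cx (cardsD1 x X) xX.
have labX : lab @: X = lab x |: [set~ i0].
  by rewrite -lx -imsetU1 finset.setD1K.
case: (eqVneq (lab x) i0) => [li|li].
  by rewrite labX li finset.setUCr.
have linj : {in X :\ x &, injective lab}.
  by apply/imset_injP; rewrite lx cardsC1 -cx.
have [x' x'D lx'] : exists2 x', x' \in X :\ x & lab x = lab x'.
  by apply/imsetP; rewrite lx !inE.
move: x'D; rewrite !inE => /andP [x'x x'X].
have : room_doors X = [set x; x'].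
  apply/setP => z; rewrite !inE; apply/andP/orP.
    move=> [zX /andP [_ /eqP lz]].
    case: (eqVneq z x) => [_|zx]; first by left.
    case: (eqVneq z x') => [_|zx']; first by right.
    (* [lab z] must be the label of a point of [X] other than [z]. *)
    have : lab z \in lab @: (X :\ z).
      rewrite lz -lx; apply: imset_f; by rewrite !inE zx.
    move=> /imsetP [w]; rewrite !inE => /andP [wz wX] lw.
    case: (eqVneq w x) => [wx|wx].
      subst w; have := linj z x'; rewrite !inE zx zX x'x x'X -lx' => /(_ isT isT lw).
      by move/eqP: zx'.
    have := linj z w; rewrite !inE zx zX wx wX => /(_ isT isT lw) zw.
    by rewrite zw eqxx in wz.
  case=> /eqP ->; first by rewrite xX /door cx lx !eqxx.
  rewrite x'X; split=> //; apply/andP; split.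
    by rewrite -cX (cardsD1 x' X) x'X.
  rewrite -lx; apply/eqP/setP => i; apply/imsetP/imsetP.
    move=> [w]; rewrite !inE => /andP [wx' wX] ->.
    case: (eqVneq w x) => [->|wx]; first by exists x' => //; rewrite !inE x'x x'X.
    by exists w => //; rewrite !inE wx wX.
  move=> [w]; rewrite !inE => /andP [wx wX] ->.
  case: (eqVneq w x') => [->|wx'].
    by exists x => //; rewrite !inE eq_sym x'x xX.
  by exists w => //; rewrite !inE wx' wX.
by move=> e; move: od; rewrite e cards2 eq_sym x'x.
Qed.

(** The pairs (D, x) with D a door and x |: D dominant are the pairs (X, x) with
    X dominant and X :\ x a door.  Counted by doors their number is odd, as
    [door0] has one extension and the other doors two or none; so some dominant X
    contributes an odd number, and it carries all the labels. *)
Lemma scarf_complete_room : exists2 X : {set U}, dominant X & lab @: X = [set: I].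
Proof.
have double_count : (\sum_(D : {set U} | door D) #|extensions D| =
                     \sum_(X : {set U} | dominant X) #|room_doors X|)%N.
  under eq_bigr do rewrite -sum1dep_card.
  under [RHS]eq_bigr do rewrite -sum1dep_card.
  rewrite (exchange_big_dep xpredT) //= [RHS](exchange_big_dep xpredT) //=.
  apply: eq_bigr => x _.
  rewrite (reindex_onto (fun X : {set U} => X :\ x) (fun D => x |: D)) /=; last first.
    by move=> D /andP [_ /andP [xD _]]; rewrite finset.setU1K.
  apply: eq_bigl => X; apply/idP/idP.
    move=> /andP [/andP [dX /andP [_ dom]] /eqP e].
    have xX : x \in X by rewrite -e !inE eqxx.
    by rewrite finset.setD1K // in dom; rewrite dom xX dX.
  move=> /andP [dom /andP [xX dX]].
  by rewrite finset.setD1K // dX dom !inE !eqxx.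
have : odd (\sum_(D : {set U} | door D) #|extensions D|)%N.
  rewrite (bigD1 door0) ?door0P //= extensions0 /= -dvdn2.
  apply: dvdn_sum => D /andP [dD nD].
  case: (boolP (dominant D)) => dom; first by rewrite (extensions2 dD nD dom).
  rewrite (_ : extensions D = (finset.set0 : {set U})) ?cards0 //; apply/setP => x; rewrite !inE.
  apply: contraNF dom => /andP [_]; apply: dominantS; exact: finset.subsetUr.
rewrite double_count => od; apply: contrapT => nX; move: od; apply/negP.
rewrite -dvdn2; apply: dvdn_sum => X dX; rewrite dvdn2.
by apply/negP => /odd_room_doors lX; apply: nX; exists X.
Qed.

(** The genuine points X and the set C of orders whose artificial point is absent
    from a completely labelled dominant set: an artificial point is least for its
    own order, so that order cannot witness domination, and it carries its own
    label, so the labels in C come from genuine points. *)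
Lemma scarf : exists (X : {set T}) (C : {set I}),
  (forall y, exists2 i, i \in C & forall x, x \in X -> (r i y <= r i x)%N) /\
  (forall i, i \in C -> exists2 x, x \in X & c x = i).
Proof.
have [X /domP dX lX] := scarf_complete_room.
exists [set t | inl t \in X], [set i | inr i \notin X]; split.
  move=> y; have [i hi] := dX (inl y); exists i.
    by rewrite inE; apply/negP => /hi /=; rewrite eqxx.
  by move=> x; rewrite inE => /hi.
move=> i; rewrite inE => iX.
have : i \in lab @: X by rewrite lX.
move=> /imsetP [[t|j] uX /= e]; first by exists t; rewrite ?inE.
by rewrite e uX in iX.
Qed.

End Scarf.

(** * A labelling lemma for grids *)

Section Grid.
Variables (m K : nat).

Local Notation grid := {x : {ffun 'I_m.+1 -> 'I_K.+1} | (\sum_i x i == K)%N}.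

Let grid_of (f : 'I_m.+1 -> nat) :
  (\sum_i f i = K)%N -> exists x : grid, forall i, val x i = f i :> nat.
Proof.
move=> sf.
have fK i : (f i < K.+1)%N by rewrite ltnS -sf (bigD1 i) //= leq_addr.
have sx : (\sum_i [ffun i => Ordinal (fK i)] i == K)%N.
  by under eq_bigr do rewrite ffunE /=; rewrite sf.
by exists (Sub [ffun i => Ordinal (fK i)] sx : grid) => i; rewrite /= ffunE.
Qed.

(** In the order i, grid points are compared by their coordinate i, ties being
    broken by the enumeration of the grid.  If X and C are given by Scarf's lemma
    and mu i is the least coordinate i of a point of X for i in C, and 0 for i
    outside C, domination forces \sum_i mu i > K - m.+1.  Since every x in X
    satisfies mu <= x and has coordinate sum K, all the points of X are close to
    mu, and so is the y below, which moreover vanishes outside C. *)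
Lemma grid_sperner (c : ('I_m.+1 -> nat) -> 'I_m.+1) :
  exists2 y : 'I_m.+1 -> nat, (\sum_i y i = K)%N &
    forall j, (0 < y j)%N -> exists x : 'I_m.+1 -> nat,
      [/\ (\sum_i x i = K)%N, c x = j &
          forall i, (x i <= y i + m.+1)%N /\ (y i <= x i + m.+1)%N].
Proof.
pose B := #|{: grid}|.
pose r i (x : grid) := (val x i * B + enum_rank x)%N.
have r_inj i : injective (r i).
  move=> x y e; apply/enum_rank_inj/ord_inj.
  have := congr1 (modn^~ B) e; rewrite /r !modnMDl !modn_small //; exact: ltn_ord.
have r_le i x y : (r i x <= r i y)%N -> (val x i <= val y i)%N.
  move=> /(leq_div2r B); rewrite /r !divnMDl; last 2 first.
  - by apply/card_gt0P; exists x.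
  - by apply/card_gt0P; exists x.
  by rewrite !divn_small ?addn0.
have [t0 _] : exists x : grid, forall i, val x i = (if i == ord0 then K else 0)%N :> nat.
  by apply: grid_of; rewrite -big_mkcond big_pred1_eq.
have [X [C [dXC lC]]] := @scarf _ _ r (fun x => c (fun i => val x i)) t0 ord0 r_inj.
have [i0 i0C _] := dXC t0.
have [x0 x0X _] := lC _ i0C.
pose mu i := if i \in C then val [arg min_(x < x0 in X) val x i]%N i : nat else 0%N.
have muP i x : x \in X -> (mu i <= val x i)%N.
  by move=> xX; rewrite /mu; case: ifP => // _; case: arg_minnP => // y _; apply.
have mu_out i : i \notin C -> mu i = 0%N by rewrite /mu => /negPf ->.
have mu_attained i : i \in C -> exists2 x, x \in X & val x i = mu i :> nat.
  by move=> iC; rewrite /mu iC; case: arg_minnP => // y yX _; exists y.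
have sum_grid (x : grid) : (\sum_i val x i)%N = K by apply/eqP; exact: (valP x).
have smu : (\sum_i mu i <= K)%N.
  by rewrite -(sum_grid x0); apply: leq_sum => i _; exact: muP.
(* Otherwise the sum leaves room to raise every [mu i] by one, which gives a
   grid point above X in all the orders of C at once. *)
have smu_big : (K < \sum_i mu i + m.+1)%N.
  rewrite ltnNge; apply/negP => h.
  pose f i := (mu i + 1 + (if i == i0 then K - (\sum_i mu i + m.+1) else 0))%N.
  have [|y hy] := @grid_of f.
    rewrite !big_split /= sum_nat_const card_ord muln1.
    by rewrite -[X in (_ + X)%N]big_mkcond big_pred1_eq subnKC.
  have [i iC hi] := dXC y.
  have [x xX xi] := mu_attained _ iC.
  have := r_le _ _ _ (hi _ xX); rewrite hy xi /f; lia.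
(* The coordinate [i0], which is in C, absorbs the defect of the sum. *)
exists (fun i => mu i + (if i == i0 then K - \sum_i mu i else 0))%N.
  by rewrite big_split /= -[X in (_ + X)%N]big_mkcond big_pred1_eq subnKC.
move=> j yj.
have jC : j \in C.
  apply: contraLR yj => jC; rewrite mu_out //; case: eqVneq => // ji.
  by rewrite ji i0C in jC.
have [x xX cx] := lC _ jC.
exists (fun i => val x i : nat); split => // i.
have hx := muP i _ xX.
have : (val x i - mu i <= K - \sum_i mu i)%N.
  rewrite -[X in (_ <= X - _)%N](sum_grid x) -sumnB; last by move=> k _; exact: muP.
  by rewrite (bigD1 i) //= leq_addr.
by case: eqVneq => _; lia.
Qed.

End Grid.

Local Open Scope classical_set_scope.
Local Open Scope ring_scope.

(** * Open coverings of the simplex *)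

Definition simplex (R : realType) (m : nat) : set 'rV[R]_m :=
  [set l | (forall i, 0 <= l ord0 i) /\ \sum_i l ord0 i = 1].

Section Simplex.
Context {R : realType}.

Lemma sum_coord_continuous m : continuous (fun l : 'rV[R]_m => \sum_i l ord0 i).
Proof.
by apply: continuous_big => // [|i _]; [exact: add_continuous|exact: coord_continuous].
Qed.

Lemma combination_continuous (V : normedModType R) m (v : 'I_m -> V) :
  continuous (fun l : 'rV[R]_m => \sum_j l ord0 j *: v j).
Proof.
apply: continuous_big => [|j _ l]; first exact: add_continuous.
exact: (cvgZr_tmp (F := nbhs l) (@coord_continuous R 1 m ord0 j l)).
Qed.

Lemma simplex_compact m : compact (@simplex R m).
Proof.
pose A := [set l : 'rV[R]_m | forall i, `[0, 1]%classic (l ord0 i)].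
apply: (@subclosed_compact _ _ A).
- rewrite (_ : @simplex R m = (\bigcap_(i in [set: 'I_m]) [set l | 0 <= l ord0 i])
     `&` [set l | \sum_i l ord0 i = 1]).
    apply: closedI.
      apply: closed_bigI => i _.
      have /continuous_closedP/(_ [set x | 0 <= x]) := @coord_continuous R 1 m ord0 i.
      by apply; exact: closed_ge.
    have /continuous_closedP/(_ [set x | x = 1]) := @sum_coord_continuous m.
    by apply; exact: closed_eq.
  apply/seteqP; split=> l /= [h1 h2]; split => //; first by move=> i _; exact: h1.
  by move=> i; exact: h1.
- apply: (@rV_compact R m (fun=> `[0, 1]%classic)) => i.
  exact: segment_compact.
- move=> l [l0 l1] i /=; rewrite in_itv /= l0 /= -l1 (bigD1 i) //=.
  by rewrite lerDl sumr_ge0.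
Qed.

Lemma simplex_lebesgue_number m (U : 'I_m -> set 'rV[R]_m) :
  (forall j, open (U j)) -> (forall l, simplex l -> exists j, U j l) ->
  exists2 e : R, 0 < e & forall l, simplex l -> exists j, ball l e `<=` U j.
Proof.
move=> oU cU.
have : \forall e \near (0 : R)^'+, @simplex R m `<=` [set l | exists j, ball l e `<=` U j].
  have := @simplex_compact m => /compact_near_coveringP.
  move=> /(_ _ (0 : R)^'+ (fun e l => exists j, ball l e `<=` U j)).
  apply => l /cU [j Ujl].
  have /nbhs_ballP [d /= d0 dU] : nbhs l (U j) by apply: open_nbhs_nbhs.
  exists (ball l (d / 2), [set e | e < d / 2]) => /=.
    split; first by apply: nbhsx_ballx; rewrite divr_gt0.
    by apply: nbhs_right_lt; rewrite divr_gt0.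
  move=> [l' e] /= [ll' ed]; exists j => l'' l'l''; apply: dU.
  rewrite (splitr d); apply: ball_triangle ll' _.
  exact: le_ball (ltW ed) _ l'l''.
move=> h; near (0 : R)^'+ => e.
by exists e; [near: e; exact: nbhs_right_gt|exact: (near h e)].
Unshelve. all: by end_near. Qed.

(** Label each point l of a grid of small mesh by some j such that the ball of
    radius e around l is included in [U j]; [grid_sperner] gives a point of the
    simplex that is e-close to a point labelled j whenever its coordinate j is
    not 0. *)
Lemma open_cover_simplex m (U : 'I_m.+1 -> set 'rV[R]_m.+1) :
  (forall j, open (U j)) -> (forall l, simplex l -> exists j, U j l) ->
  exists2 l, simplex l & forall j, l ord0 j != 0 -> U j l.
Proof.
move=> oU cU; have [e e0 eU] := simplex_lebesgue_number oU cU.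
have [K K0 Ke] : exists2 K : nat, (0 < K)%N & m.+1%:R / K%:R < e.
  exists (Num.bound (m.+1%:R / e)).+1 => //.
  rewrite ltr_pdivrMr ?ltr0n // mulrC -ltr_pdivrMr //.
  apply: lt_trans (archi_boundP _) _; first by rewrite divr_ge0 // ltW.
  by rewrite ltr_nat.
have K0' : K%:R != 0 :> R by rewrite pnatr_eq0 -lt0n.
pose pt (f : 'I_m.+1 -> nat) : 'rV[R]_m.+1 := \row_i ((f i)%:R / K%:R).
have ptS f : (\sum_i f i = K)%N -> simplex (pt f).
  move=> sf; split => [i|]; first by rewrite mxE divr_ge0.
  under eq_bigr do rewrite mxE; rewrite -mulr_suml -natr_sum sf divff //.
have /choice [c cP] : forall f : 'I_m.+1 -> nat, exists j,
    (\sum_i f i = K)%N -> ball (pt f) e `<=` U j.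
  move=> f; case: (pselect (\sum_i f i = K)%N) => [sf|]; last by exists ord0.
  by have [j hj] := eU _ (ptS _ sf); exists j.
have [y sy yP] := @grid_sperner m K c.
exists (pt y); first exact: ptS.
move=> j; rewrite mxE mulf_eq0 invr_eq0 (negPf K0') orbF pnatr_eq0 -lt0n => yj.
have [x [sx cx xy]] := yP _ yj.
rewrite -cx; apply: (cP x sx).
split => // i k; rewrite !mxE /ball /= -mulrBl normrM normfV [X in _ / X]ger0_norm //.
apply: le_lt_trans Ke; rewrite ler_pM2r ?invr_gt0 ?ltr0n //.
have [h1 h2] := xy k; rewrite ler_distl lerBlDr -!natrD !ler_nat.
by rewrite h1 h2.
Qed.

End Simplex.

(** * Convex sets *)

Section ConvexSets.
Context {R : realType} {V : lmodType R}.
Implicit Types A B : set V.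

Lemma convex_setP A : convex_set A <->
  forall x y (t : R), 0 <= t <= 1 -> A x -> A y -> A (t *: x + (1 - t) *: y).
Proof.
split=> [cA x y t /andP [t0 t1] Ax Ay|cA x y t].
  by have := cA x y (Itv01 t0 t1); rewrite !inE; apply.
rewrite !inE => Ax Ay; apply: cA => //.
by rewrite ge0 le1.
Qed.

Lemma convex_setI A B : convex_set A -> convex_set B -> convex_set (A `&` B).
Proof.
move=> /convex_setP cA /convex_setP cB; apply/convex_setP => x y t t01 [Ax Bx] [Ay By].
by split; [exact: cA|exact: cB].
Qed.

Lemma convex_sum A : convex_set A -> forall m (l : 'I_m -> R) (y : 'I_m -> V),
  (forall i, 0 <= l i) -> \sum_i l i = 1 -> (forall i, l i != 0 -> A (y i)) ->
  A (\sum_i l i *: y i).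
Proof.
move=> /convex_setP cA; elim=> [|m IH] l y l0 l1 Ay.
  by move: l1; rewrite big_ord0 => /eqP; rewrite eq_sym oner_eq0.
move: l1; rewrite !big_ord_recr /=; set t := l ord_max => l1.
have sl : \sum_(i < m) l (widen_ord (leqnSn m) i) = 1 - t by rewrite -l1 addrK.
have t1 : 0 <= 1 - t by rewrite -sl sumr_ge0.
case: (eqVneq t 1) => [t1E|t1N].
  have /psumr_eq0P z : \sum_(i < m) l (widen_ord (leqnSn m) i) = 0.
    by rewrite sl t1E subrr.
  rewrite big1 ?add0r => [|i _]; last by rewrite z ?scale0r.
  by rewrite t1E scale1r; apply: Ay; rewrite -/t t1E oner_eq0.
have t1' : 1 - t != 0 by rewrite subr_eq0 eq_sym.
pose z := \sum_(i < m) (l (widen_ord (leqnSn m) i) / (1 - t)) *: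
                       y (widen_ord (leqnSn m) i).
have Az : A z.
  apply: IH => [i||i]; first by rewrite divr_ge0.
    by rewrite -mulr_suml sl divff.
  by rewrite mulf_eq0 negb_or => /andP [+ _]; exact: Ay.
have -> : \sum_(i < m) l (widen_ord (leqnSn m) i) *: y (widen_ord (leqnSn m) i) =
          (1 - t) *: z.
  rewrite /z scaler_sumr; apply: eq_bigr => i _.
  by rewrite scalerA mulrCA divff ?mulr1.
case: (eqVneq t 0) => [->|t0]; first by rewrite subr0 scale1r scale0r addr0.
rewrite addrC; apply: cA => //; last exact: Ay.
by rewrite l0 -subr_ge0.
Qed.

End ConvexSets.

(** * Topology of profiles *)

Section ProfileTopology.
Context {R : realType} {N : finType} {n : N -> nat}.
Local Notation P := (profile R n).

Lemma profile_coord_continuous nu : continuous (fun x : P => x nu).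
Proof. exact: (@proj_continuous _ (fun nu : N => 'rV[R]_(n nu)) nu). Qed.

Lemma cvg_profile {T : Type} (F : set_system T) (f : T -> P) (x : P) :
  Filter F -> (forall nu, f t nu @[t --> F] --> x nu) -> f @ F --> x.
Proof.
move=> FF fx; apply/cvg_sup => nu A [B [[C oC <-] Cx] CA].
have /fx : nbhs (x nu) C by exact: open_nbhs_nbhs.
by apply: (@filterS _ F) => t Ct; exact: CA.
Qed.

Lemma profile_sumE (I : Type) (r : seq I) (Q : pred I) (f : I -> P) nu :
  (\sum_(i <- r | Q i) f i) nu = \sum_(i <- r | Q i) f i nu.
Proof. by elim/big_rec2: _ => // i y z _ <-. Qed.

Lemma deviate_own (x : P) nu y : deviate x y nu = y :> 'rV[R]_(n nu).
Proof. exact: dfwithin. Qed.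

Lemma deviate_other (x : P) nu (y : 'rV[R]_(n nu)) mu :
  nu != mu -> deviate x y mu = x mu.
Proof. by move=> h; exact: dfwithout. Qed.

Lemma deviate_id (x : P) nu : deviate x (x nu) = x.
Proof.
apply: functional_extensionality_dep => mu.
by have [->|ne] := eqVneq nu mu; rewrite ?deviate_own // deviate_other.
Qed.

Lemma deviate_continuous nu (z : 'rV[R]_(n nu)) : continuous (fun x : P => deviate x z).
Proof.
move=> x; apply: (cvg_profile (nbhs_filter x)) => mu; have [<-|ne] := eqVneq nu mu.
  under eq_fun do rewrite deviate_own; rewrite deviate_own; exact: cvg_cst.
under eq_fun do rewrite deviate_other //.
by rewrite deviate_other //; exact: profile_coord_continuous.
Qed.

End ProfileTopology.

(** * Browder's fixed point theorem *)

(** Finitely many of the open sets [set x | G x y] cover X, say for points y_j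
    of X.  Pulled back along l |-> \sum_j l_j *: y_j they cover a simplex, and a
    point l of it that lies in the pulled back set of every j with l_j != 0 is
    sent to some x such that all these y_j are in [G x]; hence so is their convex
    combination x. *)
Lemma browder_fixed_point {R : realType} {N : finType} {n : N -> nat}
    (X : set (profile R n)) (G : profile R n -> set (profile R n)) :
  X !=set0 -> compact X -> convex_set X ->
  (forall x, X x -> exists2 y, X y & G x y) ->
  (forall y, X y -> open [set x | G x y]) ->
  (forall x, X x -> convex_set (G x)) ->
  exists2 x, X x & G x x.
Proof.
move=> [x0 Xx0] cptX cvxX G0 oG cG.
pose T : ptopologicalType :=
  HB.pack (profile R n) (isPointed.Build (profile R n) 0).
have [D DX cov] : finite_subset_cover X (fun y => [set x | G x y]) X.
  have cptT : @compact T X by [].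
  rewrite compact_cover in cptT; apply: cptT => [y /oG //|x Xx].
  by have [y Xy Gxy] := G0 _ Xx; exists y.
pose s : seq (profile R n) := finmap.enum_fset D.
have sX y : y \in s -> X y by move=> /DX; rewrite inE.
have scov x : X x -> exists2 y, y \in s & G x y.
  by move=> /cov [y yD Gxy]; exists y.
have [m sm] : exists m, size s = m.+1.
  have [y] := scov _ Xx0; case: s {sX scov} => // a s' _ _; by exists (size s').
pose y (j : 'I_m.+1) := nth 0 s j.
have yX j : X (y j) by apply/sX/mem_nth; rewrite sm.
pose phi (l : 'rV[R]_m.+1) : profile R n := \sum_j l ord0 j *: y j.
have cphi : continuous phi.
  move=> l; apply: (cvg_profile (nbhs_filter l)) => nu; rewrite /phi profile_sumE.
  under eq_fun do rewrite profile_sumE.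
  exact: (@combination_continuous R _ _ (fun j => y j nu)).
have phiX l : simplex l -> X (phi l).
  by move=> [l0 l1]; apply: (convex_sum cvxX).
have [|l ls|l ls ly] := @open_cover_simplex R m (fun j => [set l | G (phi l) (y j)]).
- move=> j; have /continuousP/(_ [set x | G x (y j)]) := cphi.
  by apply; exact: oG.
- have [z zs Gz] := scov _ (phiX _ ls).
  have zm : (index z s < m.+1)%N by rewrite -sm index_mem.
  by exists (Ordinal zm); rewrite /= /y nth_index.
exists (phi l); first exact: phiX.
have [l0 l1] := ls; apply: (convex_sum (cG _ (phiX _ ls))) => //.
Qed.

(** * Separation in R^m *)

Definition dot {R : realType} {m : nat} (u v : 'rV[R]_m) : R :=
  \sum_i u ord0 i * v ord0 i.

Section Separation.
Context {R : realType} {m : nat}.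
Implicit Types u v w : 'rV[R]_m.

Lemma dotC u v : dot u v = dot v u.
Proof. by apply: eq_bigr => i _; rewrite mulrC. Qed.

Lemma dotDr u v w : dot u (v + w) = dot u v + dot u w.
Proof. by rewrite -big_split; apply: eq_bigr => i _; rewrite mxE mulrDr. Qed.

Lemma dotZr (t : R) u v : dot u (t *: v) = t * dot u v.
Proof. by rewrite mulr_sumr; apply: eq_bigr => i _; rewrite mxE mulrCA. Qed.

Lemma dotDl u v w : dot (u + v) w = dot u w + dot v w.
Proof. by rewrite ![dot _ w]dotC dotDr. Qed.

Lemma dot0r u : dot u 0 = 0.
Proof. by rewrite -(scale0r 0) dotZr mul0r. Qed.

Lemma dotNr u v : dot u (- v) = - dot u v.
Proof. by rewrite -scaleN1r dotZr mulN1r. Qed.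

Lemma dotZl (t : R) u v : dot (t *: u) v = t * dot u v.
Proof. by rewrite dotC dotZr dotC. Qed.

Lemma dot_ge0 u : 0 <= dot u u.
Proof. by apply: sumr_ge0 => i _; rewrite -expr2 sqr_ge0. Qed.

Lemma dot_gt0 u : u != 0 -> 0 < dot u u.
Proof.
move=> u0; rewrite lt_def dot_ge0 andbT; apply: contra_neq u0 => /psumr_eq0P h.
apply/rowP => i; rewrite mxE; apply/eqP; rewrite -sqrf_eq0 expr2 h //.
by move=> j _; rewrite -expr2 sqr_ge0.
Qed.

Lemma cvg_dot {T : Type} (F : set_system T) (f g : T -> 'rV[R]_m) u v :
  Filter F -> f @ F --> u -> g @ F --> v -> dot (f t) (g t) @[t --> F] --> dot u v.
Proof.
move=> FF fu gv; apply: cvg_big => [|i _]; first exact: add_continuous.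
have coord := @coord_continuous R 1 m ord0 i.
apply: cvgM; first exact: (@continuous_cvg _ _ _ F _ f _ _ (coord u) fu).
exact: (@continuous_cvg _ _ _ F _ g _ _ (coord v) gv).
Qed.

(** The point w of K with the least dot w w: moving from w towards z does not
    decrease the square norm, so dot w (z - w) >= 0. *)
Lemma compact_convex_separation (K : set 'rV[R]_m) :
  K !=set0 -> compact K -> convex_set K -> ~ K 0 ->
  exists w, forall z, K z -> 0 < dot w z.
Proof.
move=> K0 cK /convex_setP cvK K0N.
have cdot : continuous (fun w : 'rV[R]_m => dot w w).
  by move=> w; exact: (@cvg_dot _ _ id id w w (nbhs_filter w) cvg_id cvg_id).
have [w + wmin] := EVT_min_rV K0 cK (continuous_subspaceT cdot).
rewrite inE => Kw; exists w => z Kz.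
have w0 : 0 < dot w w by apply: dot_gt0; apply: contra_notN K0N => /eqP <-.
set b := dot w (z - w); set c := dot (z - w) (z - w).
have c0 : 0 <= c by exact: dot_ge0.
(* The square norm at [w + t *: (z - w)], compared with that at [w]. *)
have bc t : 0 < t <= 1 -> 0 <= 2 * b + t * c.
  move=> /andP [t0 t1].
  have : K (t *: z + (1 - t) *: w) by apply: cvK; rewrite ?t1 ?(ltW t0).
  rewrite -inE => /wmin.
  have -> : t *: z + (1 - t) *: w = w + t *: (z - w).
    by rewrite scalerBl scale1r scalerBr addrCA.
  rewrite dotDr dotZr !dotDl !dotZl [dot (z - w) w]dotC -/b -/c => h.
  by rewrite -(pmulr_rge0 _ t0); lra.
suff : 0 <= b by rewrite /b dotDr dotNr subr_ge0; exact: lt_le_trans w0.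
rewrite leNgt; apply/negP => b0.
(* [- b / (c + 1)] is so small that the linear term [2 * b] prevails. *)
have [h1|h1] := leP (- b / (c + 1)) 1.
  have := bc (- b / (c + 1)); rewrite h1 divr_gt0 ?oppr_gt0 //; last lra.
  move=> /(_ isT); have : - b / (c + 1) * c <= - b.
    rewrite -mulrA ger_pMr ?oppr_gt0 // ler_pdivrMl; lra.
  lra.
have := bc 1; rewrite lexx ltr01 => /(_ isT).
by move: h1; rewrite ltr_pdivlMr; lra.
Qed.

Lemma unit_sphere_compact : compact [set a : 'rV[R]_m | `|a| = 1].
Proof.
apply: bounded_closed_compact.
  exists 1; split; first exact: num_real.
  by move=> M M1 a /= ->; exact: ltW.
have /continuous_closedP/(_ [set x | x = 1]) := @norm_continuous R 'rV[R]_m.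
by apply; exact: closed_eq.
Qed.

Lemma finite_separation k (z : 'I_k.+1 -> 'rV[R]_m) (C : set 'rV[R]_m) :
  convex_set C -> ~ C 0 -> (forall j, C (z j)) ->
  exists2 a, `|a| = 1 & forall j, dot a (z j) <= 0.
Proof.
move=> cC C0 zC; pose Z (l : 'rV[R]_k.+1) := \sum_j l ord0 j *: z j.
have Zlin t l l' : Z (t *: l + (1 - t) *: l') = t *: Z l + (1 - t) *: Z l'.
  rewrite /Z !scaler_sumr -big_split; apply: eq_bigr => j _ /=.
  by rewrite !mxE !scalerA scalerDl.
have zK j : (Z @` @simplex R k.+1) (z j).
  exists (delta_mx ord0 j).
    split => [i|]; first by rewrite mxE ler0n.
    rewrite (bigD1 j) //= mxE !eqxx big1 ?addr0 // => i ij.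
    by rewrite mxE (negPf ij) andbF.
  rewrite /Z (bigD1 j) //= mxE !eqxx scale1r big1 ?addr0 // => i ij.
  by rewrite mxE (negPf ij) andbF scale0r.
have [|||[l [l0 l1] Zl]|w wP] := @compact_convex_separation (Z @` @simplex R k.+1).
- by exists (z ord0).
- apply: continuous_compact; last exact: simplex_compact.
  by apply: continuous_subspaceT; exact: combination_continuous.
- apply/convex_setP => _ _ t /andP [t0 t1] [l [l0 l1] <-] [l' [l'0 l'1] <-].
  exists (t *: l + (1 - t) *: l'); last exact: Zlin.
  split => [i|]; first by rewrite !mxE addr_ge0 // mulr_ge0 // subr_ge0.
  under eq_bigr do rewrite !mxE.
  by rewrite big_split /= -!mulr_sumr l1 l'1 !mulr1 subrKC.
- by apply: C0; rewrite -Zl; exact: (convex_sum cC).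
have w0 : w != 0.
  by apply/eqP => w0; have := wP _ (zK ord0); rewrite w0 dotC dot0r ltxx.
exists (- `|w|^-1 *: w).
  by rewrite normrZ normrN normfV normr_id mulVf // normr_eq0.
move=> j; rewrite dotZl mulNr oppr_le0 mulr_ge0 ?invr_ge0 //.
by apply: ltW; exact: wP.
Qed.

(** For finitely many points of C there is such an a, because their convex hull is
    compact and avoids 0; as the unit sphere is compact, one a serves for all the
    points of C. *)
Lemma convex_separation (C : set 'rV[R]_m) :
  C !=set0 -> convex_set C -> ~ C 0 ->
  exists2 a, `|a| = 1 & forall z, C z -> dot a z <= 0.
Proof.
move=> [z0 Cz0] cC C0; apply: contrapT => noa.
have cover a : `|a| = 1 -> exists2 z, C z & 0 < dot a z.
  move=> a1; apply: contrapT => noz; apply: noa; exists a => // z Cz.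
  by rewrite leNgt; apply/negP => h; apply: noz; exists z.
have [D DC Dcov] : finite_subset_cover C (fun z => [set a | 0 < dot a z])
    [set a : 'rV[R]_m | `|a| = 1].
  have := unit_sphere_compact; rewrite compact_cover; apply.
    move=> z _; have /continuousP/(_ [set x | 0 < x]) : continuous (dot^~ z).
      move=> a; apply: (@cvg_dot _ _ id (fun=> z) a z (nbhs_filter a) cvg_id).
      exact: cvg_cst.
    by apply; exact: open_gt.
  by move=> a /cover [z Cz az]; exists z.
pose s : seq 'rV[R]_m := z0 :: finmap.enum_fset D.
have sC z : z \in s -> C z.
  by rewrite inE => /predU1P [->|/DC]; rewrite ?inE.
have [|a a1 az] := @finite_separation (size (finmap.enum_fset D))
  (fun j => nth 0 s j) C cC C0.
  by move=> j; apply/sC/mem_nth; exact: ltn_ord.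
have [z zD /= az0] := Dcov a a1.
have zs : z \in s by rewrite inE; apply/orP; right.
have zm : (index z s < size s)%N by rewrite index_mem.
by have := az (Ordinal zm); rewrite /= nth_index // leNgt az0.
Qed.

End Separation.

(** * Games on compact convex sets *)

(** The relation f x < f y is open in both arguments together: either a value of
    f lies strictly between f x and f y and separates them, or none does, and then
    the values near x, being below f y, are at most f x, and likewise near y. *)
Lemma pseudo_continuous_near_lt {R : realType} {T : topologicalType} (f : T -> R)
    {S : Type} (F : set_system S) (g h : S -> T) (x y : T) :
  pseudo_continuous f -> Filter F -> g @ F --> x -> h @ F --> y ->
  f x < f y -> \forall s \near F, f (g s) < f (h s).
Proof.
move=> [up lo] FF gx hy xy.
have upg z : f x < f z -> \forall s \near F, f (g s) < f z by move=> /up /gx.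
have loh z : f z < f y -> \forall s \near F, f z < f (h s).
  move=> zy; have hlo : - f y < - f z by rewrite ltrN2.
  have Fh : F [set s | - f (h s) < - f z] by exact: hy (lo _ _ hlo).
  by apply: filterS Fh => s /=; rewrite ltrN2.
have [[z [xz zy]]|nz] := pselect (exists z, f x < f z /\ f z < f y).
  by apply: filterS2 (upg _ xz) (loh _ zy) => s; exact: lt_trans.
apply: filterS2 (upg _ xy) (loh _ xy) => s gy xh.
(* No value of f lies strictly between f x and f y. *)
have gx' : f (g s) <= f x.
  by rewrite leNgt; apply/negP => xg; apply: nz; exists (g s).
have hy' : f y <= f (h s).
  by rewrite leNgt; apply/negP => hy'; apply: nz; exists (h s).
exact: le_lt_trans gx' (lt_le_trans xy hy').
Qed.

Section CompactGame.
Context {R : realType} {N : finType} {n : N -> nat}.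
Variable theta : N -> profile R n -> R.
Hypothesis theta_cont : forall nu, pseudo_continuous (theta nu).
Hypothesis theta_convex : forall nu, own_quasi_convex nu (theta nu).

Definition better_replies nu (x : profile R n) : set 'rV[R]_(n nu) :=
  [set z | theta nu (deviate x z) < theta nu x].

(** The norm is constrained only when there are better replies.  Otherwise 0 is
    admitted, which matters when n nu = 0: then no vector has norm 1. *)
Definition unit_normal nu (x : profile R n) : set 'rV[R]_(n nu) :=
  [set a | forall z, better_replies x z -> dot a (z - x nu) <= 0 /\ `|a| = 1].

(** The whole family a is quantified at once, since the components of y are tied
    together by the constraint set. *)
Definition descent (x : profile R n) : set (profile R n) :=
  [set y | forall a : profile R n, (forall nu, `|a nu| <= 1) ->
    (forall nu, unit_normal x (a nu)) -> \sum_nu dot (a nu) (y nu - x nu) < 0].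


Lemma unit_normal_exists nu x :
  exists2 a : 'rV[R]_(n nu), `|a| <= 1 & unit_normal x a.
Proof.
have [[z0 z0S]|nS] := pselect (exists z : 'rV[R]_(n nu), better_replies x z); last first.
  by exists 0; rewrite ?normr0 // => z zS; case: nS; exists z.
pose C : set 'rV[R]_(n nu) := [set z | better_replies x (x nu + z)].
have [||| a a1 aC] := @convex_separation R (n nu) C.
- by exists (z0 - x nu); rewrite /C /= subrKC.
- apply/convex_setP => y z t t01 Cy Cz; rewrite /C /better_replies /=.
  have -> : x nu + (t *: y + (1 - t) *: z) = t *: (x nu + y) + (1 - t) *: (x nu + z).
    by rewrite !scalerDr addrACA -scalerDl subrKC scale1r.
  apply: le_lt_trans (theta_convex x _ _ t01) _.
  by rewrite gt_max; apply/andP; split.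
- by rewrite /C /better_replies /= addr0 deviate_id ltxx.
exists a; first by rewrite a1.
by move=> z zS; split=> //; apply: aC; rewrite /C /= subrKC.
Qed.

(** As z + t *: a is still a better reply for small t > 0, dot a (z - x nu) is at
    most - t * dot a a. *)
Lemma unit_normal_lt0 nu x (a z : 'rV[R]_(n nu)) :
  unit_normal x a -> better_replies x z -> dot a (z - x nu) < 0.
Proof.
move=> aN zS; have [_ a1] := aN z zS.
have cz : z + t *: a @[t --> (0 : R)^'+] --> z.
  have : z + t *: a @[t --> (0 : R)^'+] --> z + 0 *: a.
    apply: cvgD; first exact: cvg_cst.
    by apply: cvgZr_tmp; apply: cvg_at_right_filter; exact: cvg_id.
  by rewrite scale0r addr0.
have near_z : \forall t \near (0 : R)^'+, better_replies x (z + t *: a).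
  apply: (pseudo_continuous_near_lt (theta_cont nu)) zS; last exact: cvg_cst.
  apply: cvg_profile => mu; have [<-|ne] := eqVneq nu mu; last first.
    by under eq_fun do rewrite deviate_other //; rewrite deviate_other //; exact: cvg_cst.
  by under eq_fun do rewrite deviate_own; rewrite deviate_own; exact: cz.
have [t /= [t0 /aN [+ _]]] := filter_ex (filterI (nbhs_right_gt 0) near_z).
move=> h; apply: lt_le_trans h.
rewrite addrAC [X in _ < X]dotDr dotZr ltrDl mulr_gt0 // dot_gt0 //.
by rewrite -normr_eq0 a1 oner_eq0.
Qed.

Lemma descent_convex x : convex_set (descent x).
Proof.
apply/convex_setP => y z t /andP [t0 t1] yD zD a a1 aN.
have -> : \sum_nu dot (a nu) ((t *: y + (1 - t) *: z) nu - x nu) =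
    t * (\sum_nu dot (a nu) (y nu - x nu)) +
    (1 - t) * (\sum_nu dot (a nu) (z nu - x nu)).
  rewrite !mulr_sumr -big_split; apply: eq_bigr => nu _ /=.
  rewrite -!dotZr -dotDr; congr (dot _ _).
  rewrite !scalerBr addrACA -opprD -scalerDl subrKC scale1r //.
have := yD a a1 aN; have := zD a a1 aN.
set u := \sum_nu _; set v := \sum_nu _ => u0 v0.
have [t0'|t0'] := eqVneq t 0; first by rewrite t0' mul0r add0r subr0 mul1r.
have tp : 0 < t by rewrite lt_def t0'.
have : t * v < 0 by rewrite pmulr_rlt0.
have : (1 - t) * u <= 0 by rewrite mulr_ge0_le0 ?subr_ge0 // ltW.
lra.
Qed.

(** Failing to be a family of unit normals is an open condition on (x, a), being
    witnessed by a better reply z that violates an open inequality.  So near every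
    (x, a) either a is not admissible or the sum is negative, and compactness of
    the product of the unit balls makes this uniform in a. *)
Lemma descent_open y : open [set x | descent x y].
Proof.
rewrite openE => x xD; rewrite /interior.
pose K : set (profile R n) := [set a | forall nu, `|a nu| <= 1].
have cK : compact K.
  have := @tychonoff N (fun nu => 'rV[R]_(n nu)) (fun nu => [set a | `|a| <= 1]).
  apply => nu; apply: bounded_closed_compact.
    exists 1; split; first exact: num_real.
    by move=> M M1 a /= /le_trans; apply; exact: ltW.
  have /continuous_closedP/(_ [set x | x <= 1]) := @norm_continuous R 'rV[R]_(n nu).
  by apply; exact: closed_le.
pose P (x' a : profile R n) :=
  (forall nu, unit_normal x' (a nu)) -> \sum_nu dot (a nu) (y nu - x' nu) < 0.
suff : \forall x' \near x, K `<=` P x'.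
  move=> h; apply: (filterS (F := nbhs x)) h => x' KP a /KP.
  by apply.
apply: ((compact_near_coveringP K).1 cK _ (nbhs x) P (nbhs_filter x)) => a Ka.
have cvga nu : (p.1 : profile R n) nu @[p --> (nbhs a, nbhs x)] --> a nu.
  exact: (cvg_comp _ _ (@cvg_fst _ _ (nbhs a) (nbhs x) _) (@profile_coord_continuous _ _ _ nu a)).
have cvgx nu : (p.2 : profile R n) nu @[p --> (nbhs a, nbhs x)] --> x nu.
  exact: (cvg_comp _ _ (@cvg_snd _ _ (nbhs a) (nbhs x) _) (@profile_coord_continuous _ _ _ nu x)).
have cvgd nu (u : 'rV[R]_(n nu)) :
    dot (p.1 nu) (u - (p.2 : profile R n) nu) @[p --> (nbhs a, nbhs x)] -->
    dot (a nu) (u - x nu).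
  apply: (cvg_dot (filter_prod_filter _ _) (cvga nu)).
  exact: cvgB (cvg_cst _) (cvgx nu).
have [aN|/existsNP [nu /existsNP [z /not_implyP [zS aN]]]] :=
  pselect (forall nu, unit_normal x (a nu)).
  have : \sum_nu dot ((p.1 : profile R n) nu) (y nu - (p.2 : profile R n) nu)
      @[p --> (nbhs a, nbhs x)] --> \sum_nu dot (a nu) (y nu - x nu).
    apply: cvg_big => [|nu _]; first exact: add_continuous.
    exact: cvgd.
  move=> /cvgr_lt /(_ _ (xD a Ka aN)).
  by apply: filterS => p + _.
have zS' : \forall p \near (nbhs a, nbhs x), better_replies (p.2 : profile R n) z.
  have cvgs := @cvg_snd _ _ (nbhs a) (nbhs x) (nbhs_filter a).
  have cvgz := cvg_comp _ _ cvgs (@deviate_continuous _ _ _ nu z x).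
  exact: (pseudo_continuous_near_lt (theta_cont nu) (filter_prod_filter _ _) cvgz cvgs).
have aN' : \forall p \near (nbhs a, nbhs x),
    ~ (dot (p.1 nu) (z - (p.2 : profile R n) nu) <= 0 /\ `|p.1 nu| = 1).
  have [a1|a1] := eqVneq `|a nu| 1.
    have : 0 < dot (a nu) (z - x nu).
      by rewrite ltNge; apply/negP => h; apply: aN.
    have /cvgr_gt h := cvgd nu z.
    move=> /h; apply: filterS => p /= h' [].
    by rewrite leNgt h'.
  have /cvgr_neq0 : `|p.1 nu| - 1 @[p --> (nbhs a, nbhs x)] --> `|a nu| - 1.
    exact: cvgB (cvg_norm (cvga nu)) (cvg_cst _).
  rewrite subr_eq0 => /(_ a1); apply: filterS => p /= + [_ p1].
  by rewrite p1 subrr eqxx.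
by apply: filterS2 zS' aN' => p pS pN /(_ nu z pS) /pN.
Qed.

Lemma compact_game_equilibrium (X : set (profile R n)) :
  X !=set0 -> compact X -> convex_set X -> RGNEP theta X !=set0.
Proof.
move=> X0 cptX cvxX; apply: contrapT => noE.
have improve x : X x -> exists2 y, X y & descent x y.
  move=> Xx.
  have [nu [z [Xz zS]]] : exists nu, exists z : 'rV[R]_(n nu),
      X (deviate x z) /\ better_replies x z.
    apply: contrapT => noz; apply: noE; exists x; split=> // nu z Xz.
    by rewrite leNgt; apply/negP => zS; apply: noz; exists nu, z.
  exists (deviate x z) => // a _ aN.
  rewrite (bigD1 nu) //= deviate_own big1 ?addr0; first exact: unit_normal_lt0.
  by move=> mu ne; rewrite deviate_other 1?eq_sym // subrr dot0r.
have [x Xx xD] := browder_fixed_point X0 cptX cvxX improve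
  (fun y _ => descent_open y) (fun x _ => @descent_convex x).
pose w nu := cid2 (unit_normal_exists nu x).
have := xD (fun nu => s2val (w nu)) (fun nu => s2valP (w nu)) (fun nu => s2valP' (w nu)).
by rewrite big1 ?ltxx // => nu _; rewrite subrr dot0r.
Qed.

End CompactGame.

(** * Balls of an arbitrary norm *)

Section NormBalls.
Context {R : realType} {N : finType} {n : N -> nat}.
Variable p : profile R n -> R.
Hypothesis p_norm : is_norm p.

Lemma is_norm0 : p 0 = 0.
Proof. by case: p_norm => _ _ pZ _; rewrite -(scale0r 0) pZ normr0 mul0r. Qed.

Lemma is_norm_sum (I : Type) (r : seq I) (f : I -> profile R n) :
  p (\sum_(i <- r) f i) <= \sum_(i <- r) p (f i).
Proof.
case: p_norm => _ _ _ pD.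
elim/big_ind2: _ => //; first by rewrite is_norm0.
by move=> x a y b xa yb; apply: le_trans (pD _ _) _; exact: lerD.
Qed.

Lemma profile_basis (x : profile R n) :
  x = \sum_nu \sum_i x nu ord0 i *: deviate 0 (delta_mx ord0 i : 'rV[R]_(n nu)).
Proof.
apply: functional_extensionality_dep => nu.
rewrite profile_sumE (bigD1 nu) //= [X in _ + X]big1 ?addr0.
  rewrite profile_sumE [LHS]row_sum_delta; apply: eq_bigr => i _.
  by rewrite -[RHS]/(_ *: deviate 0 _ nu) deviate_own.
move=> mu ne; rewrite profile_sumE big1 // => i _.
by rewrite -[LHS]/(_ *: deviate 0 _ nu) deviate_other // scaler0.
Qed.

(** By the triangle inequality in a basis, p (x - y) is bounded by a weighted sum
    of the absolute values of the coordinates. *)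
Lemma is_norm_continuous : continuous p.
Proof.
case: (p_norm) => p0 _ pZ pD x.
pose c nu i := p (deviate 0 (delta_mx ord0 i : 'rV[R]_(n nu))).
pose h (y : profile R n) : R := \sum_nu \sum_i `|(x nu - y nu) ord0 i| * c nu i.
have ph y : p (x - y) <= h y.
  rewrite {1}[x - y]profile_basis; apply: le_trans (is_norm_sum _ _) _.
  apply: ler_sum => nu _; apply: le_trans (is_norm_sum _ _) _.
  by apply: ler_sum => i _; rewrite pZ.
have hx : h x = 0.
  by rewrite /h big1 // => nu _; rewrite big1 // => i _; rewrite subrr mxE normr0 mul0r.
have hcont : continuous h.
  apply: continuous_big => [|nu _]; first exact: add_continuous.
  apply: continuous_big => [|i _ y]; first exact: add_continuous.
  have sub : x nu - y' nu @[y' --> y] --> x nu - y nu.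
    exact: (cvgB (cvg_cst _ (FF := nbhs_filter y)) (@profile_coord_continuous _ _ _ nu y)).
  have coord := cvg_comp _ _ sub (@coord_continuous R 1 (n nu) ord0 i (x nu - y nu)).
  exact: (cvgM (cvg_norm coord) (cvg_cst _)).
have pN y : p (- y) = p y by rewrite -scaleN1r pZ normrN1 mul1r.
apply: (cvgrPdist_lt p (p x) (FF := nbhs_filter x)).2 => e e0.
have he : \forall y \near x, h y < e.
  by apply: (cvgr_lt (h x) (hcont x)); rewrite hx.
apply: (filterS (F := nbhs x)) he => y; apply: le_lt_trans; apply: le_trans (ph y).
have h1 := pD (x - y) y; have h2 := pD (y - x) x.
rewrite !subrK in h1 h2; rewrite -[y - x]opprB pN in h2.
by rewrite ler_norml; apply/andP; split; lra.
Qed.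

(** Let q be the sum of the norms of the components.  On the compact sphere q = 1
    the norm p is bounded below by some c > 0, so c * q <= p everywhere and the
    p-ball is a closed subset of a product of compact balls. *)
Lemma norm_closed_ball_compact rho : compact (norm_closed_ball p rho).
Proof.
case: (p_norm) => p0 pE0 pZ pD.
pose q (x : profile R n) : R := \sum_nu `|x nu|.
have q_ge x nu : `|x nu| <= q x by rewrite /q (bigD1 nu) //= lerDl sumr_ge0.
have q_continuous : continuous q.
  apply: continuous_big => [|nu _ x]; first exact: add_continuous.
  exact: (cvg_norm (@profile_coord_continuous _ _ _ nu x)).
have q0 x : 0 <= q x by exact: sumr_ge0.
have qE0 x : q x = 0 -> x = 0.
  move=> /psumr_eq0P h; apply: functional_extensionality_dep => nu.
  by apply/eqP; rewrite -normr_eq0 h.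
have qZ t x : q (t *: x) = `|t| * q x.
  by rewrite mulr_sumr; apply: eq_bigr => nu _; rewrite -normrZ.
have box_compact M : compact [set x : profile R n | forall nu, `|x nu| <= M].
  have := @tychonoff N (fun nu => 'rV[R]_(n nu)) (fun nu => [set a | `|a| <= M]).
  apply => nu; apply: bounded_closed_compact.
    exists M; split; first exact: num_real.
    by move=> M' M1 a /= /le_trans; apply; exact: ltW.
  have /continuous_closedP/(_ [set x | x <= M]) := @norm_continuous R 'rV[R]_(n nu).
  by apply; exact: closed_le.
pose S := [set x : profile R n | q x = 1].
have S_compact : compact S.
  apply: (subclosed_compact _ (box_compact 1)).
    have /continuous_closedP/(_ [set t | t = 1]) := q_continuous.
    by apply; exact: closed_eq.
  by move=> x Sx nu; rewrite -Sx.
have [c c0 cS] : exists2 c, 0 < c & forall x, S x -> c <= p x.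
  have [S0|] := pselect (S !=set0); last first.
    by move=> S0; exists 1 => // x Sx; case: S0; exists x.
  have [x + xmin] := compact_EVT_min S0 S_compact (continuous_subspaceT is_norm_continuous).
  rewrite inE => Sx; exists (p x); last by move=> y Sy; apply: xmin; rewrite inE.
  rewrite lt_def p0 andbT; apply/eqP => /pE0 x0; move: Sx.
  rewrite /S /= x0 => q1; have := qZ 0 0; rewrite scaler0 q1 normr0 mul0r => /eqP.
  by rewrite oner_eq0.
have pq x : c * q x <= p x.
  have [/qE0 ->|qx] := eqVneq (q x) 0.
    have -> : q 0 = 0 by have := qZ 0 0; rewrite scaler0 normr0 mul0r.
    by rewrite mulr0.
  have qp : 0 < q x by rewrite lt_def qx q0.
  have : S ((q x)^-1 *: x) by rewrite /S /= qZ normfV ger0_norm // mulVf.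
  by move=> /cS; rewrite pZ normfV ger0_norm // mulrC ler_pdivlMr.
apply: (subclosed_compact _ (box_compact (rho / c))).
  have /continuous_closedP/(_ [set t | t <= rho]) := is_norm_continuous.
  by apply; exact: closed_le.
move=> x xrho nu; apply: le_trans (q_ge x nu) _.
by rewrite ler_pdivlMr // mulrC; exact: le_trans (pq x) xrho.
Qed.

Lemma norm_closed_ball_convex rho : convex_set (norm_closed_ball p rho).
Proof.
case: (p_norm) => p0 pE0 pZ pD.
apply/convex_setP => x y t /andP [t0 t1] xr yr.
apply: le_trans (pD _ _) _; rewrite !pZ !ger0_norm ?subr_ge0 //.
have -> : rho = t * rho + (1 - t) * rho by rewrite -mulrDl subrKC mul1r.
by apply: lerD; apply: ler_wpM2l; rewrite ?subr_ge0.
Qed.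

End NormBalls.

(** * Generalized Nash equilibria *)

Theorem theorem5p3 (R : realType) (N : finType) (n : N -> nat)
  (p : profile R n -> R) (X : set (profile R n))
  (theta : N -> profile R n -> R) :
  (0 < #|N|)%N ->
  is_norm p ->
  convex_set X -> closed X -> X !=set0 ->
  (forall nu, pseudo_continuous (theta nu)) ->
  (exists rho : R,
    [/\ 0 < rho,
        X `&` norm_closed_ball p rho !=set0
      & forall x, (X `\` norm_closed_ball p rho) x ->
          exists2 y, strategy_sets X x y &
            forall nu,
              norm_closed_ball p rho (deviate x (y nu)) /\
              theta nu (deviate x (y nu)) <= theta nu x]) ->
  (forall nu, own_quasi_convex nu (theta nu)) ->
  RGNEP theta X !=set0.
Proof.
move=> _ p_norm cvxX clX _ theta_cont [rho [_ K0 coercive]] theta_convex.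
have cptK : compact (X `&` norm_closed_ball p rho).
  by rewrite setIC; apply: compact_closedI => //; exact: norm_closed_ball_compact.
have cvxK : convex_set (X `&` norm_closed_ball p rho).
  by apply: convex_setI => //; exact: norm_closed_ball_convex.
have [x [[Xx xrho] xE]] := compact_game_equilibrium theta_cont theta_convex K0 cptK cvxK.
exists x; split=> // nu z Xz.
rewrite leNgt; apply/negP => zS.
have [zrho|zrho] := pselect (norm_closed_ball p rho (deviate x z)).
  by have := xE nu z (conj Xz zrho); rewrite leNgt zS.
have [y yX yP] := coercive _ (conj Xz zrho).
have [yrho yz] := yP nu; have := yX nu.
have deviate2 : deviate (deviate x z) (y nu) = deviate x (y nu).
  apply: functional_extensionality_dep => mu.
  by have [<-|ne] := eqVneq nu mu; rewrite ?deviate_own ?deviate_other.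
rewrite /strategy_set /= deviate2 in yrho yz * => Xy.
by have := xE nu (y nu) (conj Xy yrho); rewrite leNgt (le_lt_trans yz zS).
Qed.
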